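(* Let $\mathfrak{D}$ be a complex vector space and let $\mathfrak{t},\mathfrak{w}$ be sesquilinear forms on $\mathfrak{D}$, with $\mathfrak{w}$ non-negative and $M(\mathfrak{t})\neq\varnothing$. Then, for any $\mathfrak{s}\in M(\mathfrak{t})$, there is a decomposition $$\mathfrak{t}=\mathfrak{t}_r+\mathfrak{t}_m+\mathfrak{t}_{ss},$$ where $\mathfrak{t}_r$ is a $\mathfrak{w}$-regular form, $\mathfrak{t}_m$ is a $\mathfrak{w}$-mixed form and $\mathfrak{t}_{ss}$ is a $\mathfrak{w}$-strongly singular form on $\mathfrak{D}$.
   Context: A sesquilinear form on a complex vector space $\mathfrak{D}$ is a map $\mathfrak{t}:\mathfrak{D}\times\mathfrak{D}\to\mathbb{C}$ linear in the first and anti-linear in the second variable; $\mathfrak{t}[\phi]:=\mathfrak{t}(\phi,\phi)$. It is non-negative if $\mathfrak{t}[\phi]\ge 0$ for all $\phi\in\mathfrak{D}$. $M(\mathfrak{t})$ is the set of non-negative sesquilinear forms $\mathfrak{s}$ on $\mathfrak{D}$ with $|\mathfrak{t}(\phi,\psi)|\le \mathfrak{s}[\phi]^{1/2}\mathfrak{s}[\psi]^{1/2}$ for all $\phi,\psi\in\mathfrak{D}$. Let $\mathfrak{w}$ be a non-negative form on $\mathfrak{D}$. - A non-negative form $\mathfrak{s}$ is $\mathfrak{w}$-absolutely continuous ($\mathfrak{s}\ll\mathfrak{w}$) if for every sequence $(\phi_n)\subset\mathfrak{D}$ with $\mathfrak{w}[\phi_n]\to0$ and $\mathfrak{s}[\phi_n-\phi_m]\to0$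 as $n,m\to\infty$, one has $\mathfrak{s}[\phi_n]\to0$. - A form $\mathfrak{t}$ is $\mathfrak{w}$-singular ($\mathfrak{t}\perp\mathfrak{w}$) if for every $\phi\in\mathfrak{D}$ there is a sequence $(\phi_n)\subset\mathfrak{D}$ with $\mathfrak{w}[\phi_n]\to0$ and $\mathfrak{t}[\phi-\phi_n]\to0$. - A form $\mathfrak{t}$ is $\mathfrak{w}$-regular if there is $\mathfrak{s}\in M(\mathfrak{t})$ with $\mathfrak{s}\ll\mathfrak{w}$. - A form $\mathfrak{t}$ is $\mathfrak{w}$-strongly singular if there is $\mathfrak{s}\in M(\mathfrak{t})$ with $\mathfrak{s}\perp\mathfrak{w}$. - A form $\mathfrak{t}$ is $\mathfrak{w}$-mixed if there are non-negative forms $\mathfrak{a},\mathfrak{b}$ on $\mathfrak{D}$ with $\mathfrak{a}\ll\mathfrak{w}$, $\mathfrak{b}\perp\mathfrak{w}$, $\mathfrak{a}\perp\mathfrak{b}$ and $|\mathfrak{t}[\phi]|\le\mathfrak{a}[\phi]^{1/2}\mathfrak{b}[\phi]^{1/2}$ for all $\phi\in\mathfrak{D}$. *)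

(* Defs.v *)
From mathcomp Require Import all_boot all_order all_algebra.
From mathcomp Require Import complex.
From mathcomp Require Import all_classical all_reals all_analysis.

Set Implicit Arguments.
Unset Strict Implicit.
Unset Printing Implicit Defensive.

Import Order.TTheory GRing.Theory Num.Theory.
Import numFieldNormedType.Exports.

Local Open Scope classical_set_scope.
Local Open Scope ring_scope.

(* Linear in the first variable, anti-linear in the second. *)
Notation "{ 'sesquiform' D }" :=
  {bilinear D -> D -> _ | *%R & (Num.conj \; *%R)}
  (format "{ 'sesquiform'  D }") : ring_scope.

Section SesquilinearForms.
Context {R : realType} {D : lmodType R[i]}.
Implicit Types (phi psi : D) (t s w a b : {sesquiform D}).

Definition qform t phi : R[i] := t phi phi.

(* The order of R[i] is partial: 0 <= z means that z is real and z >= 0. *)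
Definition nonneg_form t : Prop := forall phi, 0 <= qform t phi.

(* M(t); for a non-negative form s, sqrtC (s[phi]) is the usual square root of
   the real number s[phi]. *)
Definition majorants t : set {sesquiform D} :=
  [set s | nonneg_form s /\
    forall phi psi, `|t phi psi| <= sqrtC (qform s phi) * sqrtC (qform s psi)].

(* R[i]^o is R[i] with the topology of its norm. *)
Definition abs_continuous s w : Prop :=
  forall u : nat -> D,
    qform w (u n) @[n --> \oo] --> (0 : R[i]^o) ->
    qform s (u nm.1 - u nm.2) @[nm --> (\oo, \oo)] --> (0 : R[i]^o) ->
    qform s (u n) @[n --> \oo] --> (0 : R[i]^o).

(* t need not be non-negative: the second limit is that of a complex sequence. *)
Definition singular t w : Prop :=
  forall phi, exists u : nat -> D,
    qform w (u n) @[n --> \oo] --> (0 : R[i]^o) /\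
    qform t (phi - u n) @[n --> \oo] --> (0 : R[i]^o).

Definition regular t w : Prop :=
  exists s, majorants t s /\ abs_continuous s w.

Definition strongly_singular t w : Prop :=
  exists s, majorants t s /\ singular s w.

Definition mixed t w : Prop :=
  exists a b, [/\ nonneg_form a /\ nonneg_form b,
    abs_continuous a w, singular b w, singular a b &
    forall phi, `|qform t phi| <= sqrtC (qform a phi) * sqrtC (qform b phi)].

End SesquilinearForms.

(* Main.v *)
(* In the Hilbert space H completing (D, s), let P be the orthogonal projection
   onto the space of limits of w-null sequences, Q = 1 - P, and write
   t(x, y) = <T x, y>. Then t_r = <T Q x, Q y>, t_ss = <T P x, P y>, and t_m
   collects the two cross terms; they are controlled by the Lebesgue parts
   s_r[x] = |Q x|^2 and s_s[x] = |P x|^2 of s.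
   H is avoided: P x is represented by a sequence p x in D that minimizes
   s[x - v] over w[v] -> 0, and every form above is a limit along such
   sequences. Since s_r[x] = sup_(d > 0) inf {s[x - v] : w[v] < d} satisfies
   s_r[x] <= liminf s_r[x - v] as w[v] -> 0, it is w-absolutely continuous; this
   inequality also gives all the singularity claims. *)
Require Import Defs.
From HB Require Import structures.
From mathcomp Require Import all_boot all_order all_algebra.
From mathcomp Require Import complex.
From mathcomp Require Import all_classical all_reals all_analysis.
From mathcomp Require Import ring lra.

Import Order.TTheory GRing.Theory Num.Theory.
Import numFieldNormedType.Exports.

Local Open Scope classical_set_scope.
Local Open Scope ring_scope.
Local Notation Cabs := ComplexField.Normc.normc.

(** * Real-valued modulus on [R[i]] and limits of complex families *)

Section ComplexNorm.
Local Open Scope complex_scope.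
Context {R : realType}.
Implicit Types (z : R[i]).

Lemma normC_Cabs z : `|z| = (Cabs z)%:C.
Proof. by []. Qed.

Lemma Cabs_ge0 z : 0 <= Cabs z.
Proof. by rewrite -(@ler0c R) -normC_Cabs normr_ge0. Qed.

Lemma Cabs_real (x : R) : 0 <= x -> Cabs x%:C = x.
Proof.
by move=> x0; apply: (@complexI R); rewrite -normC_Cabs ger0_norm // ler0c.
Qed.

Lemma sqr_Cabs z : (Cabs z ^+ 2)%:C = z * Num.conj z.
Proof. by rewrite -normCK normC_Cabs rmorphXn. Qed.

Lemma Cabs_triangle (x y : R[i]) : Cabs (x + y) <= Cabs x + Cabs y.
Proof. exact: le_normcD. Qed.

Lemma CabsN (x : R[i]) : Cabs (- x) = Cabs x.
Proof. exact: normcN. Qed.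

Lemma Cabs_dist (x y : R[i]) : `|Cabs x - Cabs y| <= Cabs (x - y).
Proof.
have := Cabs_triangle (x - y) y; have := Cabs_triangle (y - x) x.
by rewrite !subrK -(CabsN (y - x)) opprB => *; apply/ler_normlP; split; lra.
Qed.

Lemma abs_Re_le_Cabs z : `|complex.Re z| <= Cabs z.
Proof. by rewrite -(@lecR R) -normC_Cabs normc_ge_Re. Qed.

Lemma abs_Im_le_Cabs z : `|complex.Im z| <= Cabs z.
Proof.
by case: z => a b /=; rewrite -sqrtr_sqr ler_wsqrtr // lerDr sqr_ge0.
Qed.

Lemma Cabs_le_ReIm z : Cabs z <= `|complex.Re z| + `|complex.Im z|.
Proof.
case: z => a b /=; rewrite -(@ler_pXn2r _ 2) ?nnegrE ?sqrtr_ge0 ?addr_ge0 //.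
rewrite sqr_sqrtr ?addr_ge0 ?sqr_ge0 // sqrrD !real_normK ?num_real //.
by rewrite addrAC lerDl mulrn_wge0 // mulr_ge0.
Qed.

Lemma sqrtC_real (x : R) : 0 <= x -> sqrtC x%:C = (Num.sqrt x)%:C.
Proof.
by move=> x0; rewrite -{1}(sqr_sqrtr x0) rmorphXn /= sqrCK // ler0c sqrtr_ge0.
Qed.

Section Cvg.
Context {T : Type} {F : set_system T} {FF : Filter F}.

Lemma cvgC_Cabs (f : T -> R[i]) (l : R[i]) :
  f x @[x --> F] --> (l : R[i]^o) <-> Cabs (f x - l) @[x --> F] --> (0 : R).
Proof.
split=> fl.
  apply/cvgr0Pnorm_lt => e e0; move/(@cvgrPdist_lt R[i] R[i]^o): fl => fl.
  have := fl e%:C; rewrite ltcR => /(_ e0); apply: filterS => x.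
  by rewrite distrC normC_Cabs ltcR ger0_norm ?Cabs_ge0.
(* A positive element of [R[i]] has zero imaginary part, so the complex tolerance is a real one. *)
apply/(@cvgrPdist_lt R[i] R[i]^o) => -[e e']; rewrite ltcE /= => /andP[/eqP -> e0].
have /cvgr0Pnorm_lt/(_ e e0) := fl; apply: filterS => x.
by rewrite distrC normC_Cabs ltcR ger0_norm ?Cabs_ge0.
Qed.

Lemma cvgC0_real (f : T -> R) : (forall x, 0 <= f x) ->
  (f x)%:C @[x --> F] --> (0 : R[i]^o) <-> f x @[x --> F] --> (0 : R).
Proof.
move=> f0; rewrite cvgC_Cabs; split; apply: cvg_trans; apply: near_eq_cvg;
  by apply: nearW => x; rewrite subr0 Cabs_real.
Qed.

End Cvg.

Lemma cvg_null_le {T : Type} {F : set_system T} {FF : Filter F} (g f : T -> R) :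
  (forall x, 0 <= f x <= g x) -> g x @[x --> F] --> (0 : R) ->
  f x @[x --> F] --> (0 : R).
Proof.
move=> fg g0; apply: (@squeeze_cvgr _ _ _ _ (cst 0) _ _ _ _ (cvg_cst _) g0).
by apply: nearW => x; exact: fg.
Qed.

Lemma cvg0_mul_bounded {T : Type} {F : set_system T} {FF : Filter F}
    (f g : T -> R) (B : R) :
  f x @[x --> F] --> (0 : R) -> (\forall x \near F, `|g x| <= B) ->
  f x * g x @[x --> F] --> (0 : R).
Proof.
move=> f0 gB; apply/cvgr0Pnorm_lt => e e0.
have B0 : 0 < `|B| + 1 by rewrite ltr_wpDl.
have /cvgr0Pnorm_lt/(_ _ (divr_gt0 e0 B0)) := f0.
apply: filterS2 gB => x gx fx; rewrite normrM.
apply: (@le_lt_trans _ _ (`|f x| * (`|B| + 1))); last by rewrite -ltr_pdivlMr.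
by rewrite ler_wpM2l // (le_trans gx) // (le_trans (ler_norm _)) // lerDl.
Qed.

Lemma cvgC_unique {T : Type} {F : set_system T} {FF : ProperFilter F}
    (f : T -> R[i]) (l l' : R[i]) :
  f x @[x --> F] --> (l : R[i]^o) -> f x @[x --> F] --> (l' : R[i]^o) -> l = l'.
Proof. exact: (@cvg_unique R[i]^o (@norm_hausdorff R[i] R[i]^o)). Qed.

Lemma cauchy_cvg_real (x : nat -> R) :
  `|x nm.1 - x nm.2| @[nm --> (\oo, \oo)] --> (0 : R) ->
  exists l : R, x n @[n --> \oo] --> l.
Proof.
move=> x_cauchy; apply/cvg_ex/cauchy_cvgP/cauchy_exP => e e0.
have /cvgr0Pnorm_lt/(_ e e0) := x_cauchy.
case=> -[A B] /= [] /= [N _ NA] [M _ MB] AB.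
exists (x N); near=> n; rewrite /ball /=.
have := AB (N, n); rewrite /= normr_id; apply; split; first exact: (NA _ (leqnn N)).
by apply: MB; rewrite /=; near: n; exact: nbhs_infty_ge.
Unshelve. all: by end_near.
Qed.

Lemma cauchy_cvgC (x : nat -> R[i]) :
  Cabs (x nm.1 - x nm.2) @[nm --> (\oo, \oo)] --> (0 : R) ->
  exists l : R[i], x n @[n --> \oo] --> (l : R[i]^o).
Proof.
move=> x_cauchy.
have [a xa] : exists l : R, complex.Re (x n) @[n --> \oo] --> l.
  apply: cauchy_cvg_real; apply: cvg_null_le x_cauchy => nm.
  by rewrite normr_ge0 -raddfB abs_Re_le_Cabs.
have [b xb] : exists l : R, complex.Im (x n) @[n --> \oo] --> l.
  apply: cauchy_cvg_real; apply: cvg_null_le x_cauchy => nm.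
  by rewrite normr_ge0 -raddfB abs_Im_le_Cabs.
exists (a +i* b); apply/cvgC_Cabs.
apply: (@cvg_null_le _ _ _ (fun n => `|complex.Re (x n) - a| + `|complex.Im (x n) - b|)).
  by move=> n; rewrite Cabs_ge0 (le_trans (Cabs_le_ReIm _)) // !raddfB.
rewrite -[X in _ --> X]addr0; by apply: cvgD; apply/norm_cvg0P/subr_cvg0.
Qed.

End ComplexNorm.

(** * Real quadratic form of a non-negative form, and Cauchy-Schwarz *)

Section QuadraticForm.
Local Open Scope complex_scope.
Context {R : realType} {D : lmodType R[i]}.
Implicit Types (s t : {sesquiform D}) (x y : D).

Definition sqn s x : R := complex.Re (qform s x).

Lemma nonneg_qformE s x : nonneg_form s -> qform s x = (sqn s x)%:C.
Proof. by move=> s0; rewrite RRe_real // ger0_real. Qed.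

Lemma sqn_ge0 s x : nonneg_form s -> 0 <= sqn s x.
Proof. by move=> s0; rewrite -ler0c -nonneg_qformE. Qed.

(** Turns the complex limits of the definitions into real ones; [f] is left free so that explicit
    formulas such as [k * reg x] can replace [sqn s]. *)
Lemma cvg0_qform s (f : D -> R) {T : Type} {F : set_system T} {FF : Filter F}
    (u : T -> D) :
  (forall x, 0 <= f x) -> (forall x, qform s x = (f x)%:C) ->
  qform s (u i) @[i --> F] --> (0 : R[i]^o) <-> f (u i) @[i --> F] --> (0 : R).
Proof.
move=> f0 sE; have -> : (fun i => qform s (u i)) = (fun i => (f (u i))%:C).
  by apply/funext => i.
by apply: (cvgC0_real (fun i => f (u i))) => i; exact: f0.
Qed.

(** Polarization: the values of the form at [x + y] and [x + i y] are real, which fixes the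
    imaginary and the real part of [s y x] respectively. *)
Lemma nonneg_form_hermitian s x y :
  nonneg_form s -> s y x = Num.conj (s x y).
Proof.
move=> s0; have im z : complex.Im (s z z) = 0 by exact: ger0_Im (s0 z).
have e1 : complex.Im (s x y + s y x) = 0.
  have := im (x + y); rewrite linearDl !linearDr !raddfD /= !im.
  by rewrite addr0 add0r.
have e2 : complex.Im ('i%C * (s y x - s x y)) = 0.
  have := im (x + 'i%C *: y).
  rewrite linearDl !linearDr !linearZl_LR !linearZr_LR /=.
  case: (s x y) (s y x) (s x x) (im x) (s y y) (im y) =>
    [a b] [c d] [p q] /= -> [r u] /= ->; simpc => /=.
  lra.
case: (s x y) (s y x) e1 e2 => [a b] [c d] /=; simpc => /= e1 e2.
by apply/eqP; rewrite eq_complex /=; apply/andP; split; apply/eqP; lra.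
Qed.

Lemma sqnZ s (c : R[i]) x : sqn s (c *: x) = Cabs c ^+ 2 * sqn s x.
Proof.
rewrite /sqn /qform linearZl_LR linearZr_LR /= mulrA -sqr_Cabs.
by case: (s x x) => a b; simpc.
Qed.

Lemma sqnN s x : sqn s (- x) = sqn s x.
Proof. by rewrite /sqn /qform linearNl linearNr opprK. Qed.

Lemma sqn0 s : sqn s 0 = 0.
Proof. by rewrite /sqn /qform linear0l. Qed.

Lemma sqn_parallelogram s x y :
  sqn s (x + y) + sqn s (x - y) = 2 * (sqn s x + sqn s y).
Proof.
rewrite /sqn /qform !(linearDl, linearDr, linearNl, linearNr) !(raddfD, raddfN) /=.
ring.
Qed.

Lemma sqnD_le s x y :
  nonneg_form s -> sqn s (x + y) <= 2 * (sqn s x + sqn s y).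
Proof.
by move=> s0; rewrite -sqn_parallelogram lerDl sqn_ge0.
Qed.

Lemma sqnB_le s x y :
  nonneg_form s -> sqn s (x - y) <= 2 * (sqn s x + sqn s y).
Proof. by move=> s0; rewrite -(sqnN s y) sqnD_le. Qed.

Lemma sqnD s x y : nonneg_form s ->
  sqn s (x + y) = sqn s x + sqn s y + 2 * complex.Re (s x y).
Proof.
move=> s0; rewrite /sqn /qform linearDl !linearDr (nonneg_form_hermitian s x y) //.
rewrite !raddfD /=; case: (s x y) => a b; rewrite /=; ring.
Qed.

Lemma sqnB_projection s x y (tau : R) : nonneg_form s ->
  sqn s (x - (tau%:C * s x y) *: y) =
  sqn s x - 2 * tau * Cabs (s x y) ^+ 2 + tau ^+ 2 * Cabs (s x y) ^+ 2 * sqn s y.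
Proof.
move=> s0; rewrite sqnD // sqnN sqnZ linearNr linearZr_LR /=.
have -> : Num.conj (tau%:C * s x y) * s x y = (tau * Cabs (s x y) ^+ 2)%:C.
  rewrite [Num.conj _]rmorphM /= -mulrA [_ * s x y]mulrC -sqr_Cabs [RHS]rmorphM.
  by congr (_ * _); exact: conjc_real.
rewrite ComplexField.Normc.normcM exprMn.
have -> : Cabs tau%:C ^+ 2 = tau ^+ 2.
  by rewrite /= expr0n addr0 sqr_sqrtr // sqr_ge0.
rewrite raddfN /=; ring.
Qed.

Lemma Cauchy_Schwarz s x y : nonneg_form s ->
  Cabs (s x y) ^+ 2 <= sqn s x * sqn s y.
Proof.
move=> s0; set c2 := Cabs _ ^+ 2.
have P tau : 0 <= sqn s x - 2 * tau * c2 + tau ^+ 2 * c2 * sqn s y.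
  by rewrite -sqnB_projection // sqn_ge0.
have c0 : 0 <= c2 by rewrite sqr_ge0.
have x0 := sqn_ge0 s x s0; have y0 := sqn_ge0 s y s0.
have [y_gt0|] := ltP 0 (sqn s y).
  have := P (sqn s y)^-1.
  have -> : sqn s x - 2 * (sqn s y)^-1 * c2 + (sqn s y)^-1 ^+ 2 * c2 * sqn s y
    = sqn s x - c2 / sqn s y by field; rewrite gt_eqF.
  by rewrite subr_ge0 ler_pdivrMr.
move=> y_le0; have {y_le0}y0 : sqn s y = 0 by apply/eqP; rewrite eq_le y_le0.
have [c_gt0|] := ltP 0 c2; last by rewrite y0 mulr0.
(* For [s[y] = 0] the bound [P] is affine in [tau] with slope [- 2 * c2]; this [tau] makes it
   negative, a contradiction. *)
have := P ((sqn s x + 1) / c2); rewrite y0.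
have -> : sqn s x - 2 * ((sqn s x + 1) / c2) * c2 +
  ((sqn s x + 1) / c2) ^+ 2 * c2 * 0 = - sqn s x - 2 by field; rewrite gt_eqF.
lra.
Qed.

(** The bound in [majorants], squared and stated in the reals: without square roots it passes easily
    to limits. *)
Definition dominates s t :=
  forall x y, Cabs (t x y) ^+ 2 <= sqn s x * sqn s y.

Lemma sqrtC_qform s x : nonneg_form s ->
  sqrtC (qform s x) = (Num.sqrt (sqn s x))%:C.
Proof. by move=> s0; rewrite nonneg_qformE // sqrtC_real // sqn_ge0. Qed.

(** Two forms are allowed because the bound for a mixed form involves two different ones. *)
Lemma le_sqrtC_qform s s' x y (z : R[i]) :
  nonneg_form s -> nonneg_form s' ->
  `|z| <= sqrtC (qform s x) * sqrtC (qform s' y) <->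
  Cabs z ^+ 2 <= sqn s x * sqn s' y.
Proof.
move=> s0 s0'; rewrite !sqrtC_qform // -rmorphM normC_Cabs lecR -sqrtrM ?sqn_ge0 //.
rewrite -[_ <= Num.sqrt _](@ler_pXn2r _ 2) ?nnegrE ?Cabs_ge0 ?sqrtr_ge0 //.
by rewrite sqr_sqrtr // mulr_ge0 // sqn_ge0.
Qed.

Lemma majorants_dominates s t :
  majorants t s <-> nonneg_form s /\ dominates s t.
Proof.
split=> -[s0 st]; split=> // x y; first exact/le_sqrtC_qform.
exact/le_sqrtC_qform.
Qed.

Lemma bilinear_sesquiform (f : D -> D -> R[i]) :
  (forall a x x' y, f (a *: x + x') y = a * f x y + f x' y) ->
  (forall a x y y', f x (a *: y + y') = Num.conj a * f x y + f x y') ->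
  exists t, forall x y, t x y = f x y.
Proof.
move=> fl fr.
pose f_bilinear := bilinear_isBilinear.Build R[i] D D R[i] *%R
  (Num.conj \; *%R) f (fun y a x x' => fl a x x' y, fun x a y y' => fr a x y y').
pose t : {sesquiform D} := HB.pack f f_bilinear.
by exists t.
Qed.

End QuadraticForm.

Lemma subrBBr {V : zmodType} (x a b : V) : (x - b) - (x - a) = a - b.
Proof. by rewrite opprB addrC addrA subrK. Qed.

(** * Limits of a dominated form along Cauchy families *)

Section Extension.
Context {R : realType} {D : lmodType R[i]}.
Variables (s t : {sesquiform D}).
Hypotheses (s0 : nonneg_form s) (st : dominates s t).

Section Null.
Context {T : Type} {F : set_system T} {FF : Filter F}.
Implicit Types (u v : T -> D).

Lemma cvg0_form u v : sqn s (u i) * sqn s (v i) @[i --> F] --> (0 : R) ->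
  Cabs (t (u i) (v i)) @[i --> F] --> (0 : R).
Proof.
move=> uv0; apply/cvgr0Pnorm_lt => e e0.
have /cvgr0Pnorm_lt/(_ _ (exprn_gt0 2 e0)) := uv0; apply: filterS => i uvi.
rewrite ger0_norm ?Cabs_ge0 // -(@ltr_pXn2r _ 2) ?nnegrE ?Cabs_ge0 ?(ltW e0) //.
exact: le_lt_trans (st _ _) (le_lt_trans (ler_norm _) uvi).
Qed.

Lemma cvg0_form_l u v (B : R) :
  sqn s (u i) @[i --> F] --> (0 : R) -> (\forall i \near F, sqn s (v i) <= B) ->
  Cabs (t (u i) (v i)) @[i --> F] --> (0 : R).
Proof.
move=> u0 vB; apply: cvg0_form; apply: (cvg0_mul_bounded _ _ B u0).
by apply: filterS vB => i; rewrite ger0_norm // sqn_ge0.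
Qed.

Lemma cvg0_form_r u v (B : R) :
  sqn s (u i) @[i --> F] --> (0 : R) -> (\forall i \near F, sqn s (v i) <= B) ->
  Cabs (t (v i) (u i)) @[i --> F] --> (0 : R).
Proof.
move=> u0 vB; apply: cvg0_form; under eq_fun do rewrite mulrC.
apply: (cvg0_mul_bounded _ _ B u0).
by apply: filterS vB => i; rewrite ger0_norm // sqn_ge0.
Qed.

End Null.

(** Encodes a linear map from [D] to the completion of [(D, s)]: [p x] is a Cauchy sequence
    representing the image of [x], and linearity holds up to [s]-null sequences. *)
Definition asymptotically_linear (p : D -> nat -> D) :=
  (forall x, sqn s (p x nm.1 - p x nm.2) @[nm --> (\oo, \oo)] --> (0 : R)) /\
  forall a x y, sqn s (p (a *: x + y) n - (a *: p x n + p y n)) @[n --> \oo]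
                  --> (0 : R).

Lemma asymptotically_linear_bounded p x : asymptotically_linear p ->
  exists B, \forall n \near \oo, sqn s (p x n) <= B.
Proof.
move=> [/(_ x)/cvgr0Pnorm_lt/(_ 1 ltr01)].
case=> -[A B] /= [] /= [N _ NA] [M _ MB] AB _.
exists (2 * (1 + sqn s (p x N))); near=> n.
rewrite -[p x n](subrK (p x N)) (le_trans (sqnD_le _ _ _ s0)) //.
rewrite ler_pM2l // lerD2r -sqnN opprB.
apply: ltW; apply: (le_lt_trans (ler_norm _)).
apply: (AB (N, n)); split; first exact: (NA _ (leqnn N)).
by apply: MB; rewrite /=; near: n; exact: nbhs_infty_ge.
Unshelve. all: by end_near.
Qed.

(** Passes from a projection to its complement [Q = 1 - P]. *)
Lemma asymptotically_linearB p :
  asymptotically_linear p -> asymptotically_linear (fun x n => x - p x n).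
Proof.
move=> [pC pL]; split=> [x|a x y].
  apply: cvg_trans (pC x); apply: near_eq_cvg; apply: nearW => nm.
  by rewrite subrBBr -sqnN opprB.
apply: cvg_trans (pL a x y); apply: near_eq_cvg; apply: nearW => n.
by rewrite scalerBr addrACA -opprD subrBBr -sqnN opprB.
Qed.

Lemma near_fst_infty (P : nat -> Prop) :
  (\forall n \near \oo, P n) -> \forall nm \near (\oo, \oo), P (nm : nat * nat).1.
Proof. by move=> H; apply: (cvg_fst H). Qed.

Lemma near_snd_infty (P : nat -> Prop) :
  (\forall n \near \oo, P n) -> \forall nm \near (\oo, \oo), P (nm : nat * nat).2.
Proof. by move=> H; apply: (cvg_snd H). Qed.

(** Splitting the increment of [t (p x n) (q y n)] leaves two terms, each with one [s]-null and one
    [s]-bounded argument, so the sequence is Cauchy. Its limit is sesquilinear because the linearity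
    defects of [p] and [q] are [s]-null and limits are unique. *)
Lemma extension_form p q :
  asymptotically_linear p -> asymptotically_linear q ->
  exists T : {sesquiform D}, forall x y,
    t (p x n) (q y n) @[n --> \oo] --> (T x y : R[i]^o).
Proof.
move=> pA qA.
have bp x := asymptotically_linear_bounded p x pA.
have bq x := asymptotically_linear_bounded q x qA.
have [pC pL] := pA; have [qC qL] := qA.
have ex (xy : D * D) : exists l : R[i],
    t (p xy.1 n) (q xy.2 n) @[n --> \oo] --> (l : R[i]^o).
  case: xy => x y; apply: cauchy_cvgC => /=.
  have [B xB] := bp x; have [B' yB'] := bq y.
  pose g (nm : nat * nat) := Cabs (t (p x nm.1 - p x nm.2) (q y nm.1)) +
    Cabs (t (p x nm.2) (q y nm.1 - q y nm.2)).
  apply: (@cvg_null_le _ _ _ _ g) => [nm|].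
    rewrite Cabs_ge0 /g (le_trans _ (Cabs_triangle _ _)) //.
    by rewrite linearBl linearBr addrA subrK.
  rewrite -[X in _ --> X]addr0; apply: cvgD.
    by apply: (cvg0_form_l _ _ B') => //; exact: near_fst_infty yB'.
  by apply: (cvg0_form_r _ _ B) => //; exact: near_snd_infty xB.
have [l tl] := choice ex.
have l_unique x y (m : R[i]) :
    t (p x n) (q y n) @[n --> \oo] --> (m : R[i]^o) -> l (x, y) = m.
  exact: cvgC_unique (tl (x, y)).
have [T TE] : exists T : {sesquiform D}, forall x y, T x y = l (x, y).
  apply: bilinear_sesquiform => [a x x' y|a x y y']; apply: l_unique.
    have [B yB] := bq y.
    have -> : (fun n => t (p (a *: x + x') n) (q y n)) = (fun n =>
       t (p (a *: x + x') n - (a *: p x n + p x' n)) (q y n) +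
       (a * t (p x n) (q y n) + t (p x' n) (q y n))).
      by apply/funext => n; rewrite linearBl linearDl linearZl_LR subrK.
    rewrite -[X in _ --> (X : R[i]^o)]add0r.
    apply: (@cvgD R[i] R[i]^o).
      by apply/cvgC_Cabs; under eq_fun do rewrite subr0; exact: cvg0_form_l yB.
    apply: (@cvgD R[i] R[i]^o); last exact: (tl (x', y)).
    by apply: cvgMl_tmp; exact: (tl (x, y)).
  have [B xB] := bp x.
  have -> : (fun n => t (p x n) (q (a *: y + y') n)) = (fun n =>
     t (p x n) (q (a *: y + y') n - (a *: q y n + q y' n)) +
     (Num.conj a * t (p x n) (q y n) + t (p x n) (q y' n))).
    by apply/funext => n; rewrite linearBr linearDr linearZr_LR subrK.
  rewrite -[X in _ --> (X : R[i]^o)]add0r.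
  apply: (@cvgD R[i] R[i]^o).
    by apply/cvgC_Cabs; under eq_fun do rewrite subr0; exact: cvg0_form_r xB.
  apply: (@cvgD R[i] R[i]^o); last exact: (tl (x, y')).
  by apply: cvgMl_tmp; exact: (tl (x, y)).
by exists T => x y; rewrite TE; exact: (tl (x, y)).
Qed.

Lemma Cabs_lim_le (u v : nat -> D) (l : R[i]) (a b : R) :
  t (u n) (v n) @[n --> \oo] --> (l : R[i]^o) ->
  sqn s (u n) @[n --> \oo] --> a -> sqn s (v n) @[n --> \oo] --> b ->
  Cabs l ^+ 2 <= a * b.
Proof.
move=> /cvgC_Cabs tl ua vb.
have cl : Cabs (t (u n) (v n)) @[n --> \oo] --> Cabs l.
  apply/subr_cvg0/norm_cvg0P; apply: cvg_null_le tl => n.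
  by rewrite normr_ge0 Cabs_dist.
have cl2 : Cabs (t (u n) (v n)) ^+ 2 @[n --> \oo] --> Cabs l ^+ 2.
  by rewrite expr2; under eq_fun do rewrite expr2; exact: cvgM.
apply: (ler_cvg_to cl2 (cvgM ua vb)); apply: nearW => n; exact: st.
Qed.

End Extension.

(** * The regular part of the quadratic form and its minimizing sequences *)

Section RegularPart.
Local Open Scope complex_scope.
Context {R : realType} {D : lmodType R[i]}.
Variables (s w : {sesquiform D}).
Hypotheses (s0 : nonneg_form s) (w0 : nonneg_form w).

Definition reg_sqn_lower x : set R :=
  [set r | exists2 d, 0 < d & forall v, sqn w v < d -> r <= sqn s (x - v)].

(* [sup_(d > 0) inf {s[x - v] : w[v] < d}]: the squared [s]-distance from [x] to
   the limits of [s]-Cauchy, [w]-null sequences. *)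
Definition reg_sqn x : R := sup (reg_sqn_lower x).

Lemma has_sup_reg_sqn_lower x : has_sup (reg_sqn_lower x).
Proof.
split; first by exists 0, 1 => // v _; exact: sqn_ge0.
by exists (sqn s x) => r [d d0 /(_ 0)]; rewrite sqn0 subr0; exact.
Qed.

Lemma reg_sqn_ge0 x : 0 <= reg_sqn x.
Proof.
apply: sup_upper_bound; first exact: has_sup_reg_sqn_lower.
by exists 1 => // v _; exact: sqn_ge0.
Qed.

Lemma reg_sqn_le x : reg_sqn x <= sqn s x.
Proof.
apply: ge_sup; first exact: (has_sup_reg_sqn_lower x).1.
by move=> r [d d0 /(_ 0)]; rewrite sqn0 subr0; exact.
Qed.

Lemma reg_sqn_lt x e : 0 < e ->
  exists2 d, 0 < d & forall v, sqn w v < d -> reg_sqn x - e < sqn s (x - v).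
Proof.
move=> e0; have [r [d d0 rle] lt_r] := sup_adherent e0 (has_sup_reg_sqn_lower x).
by exists d => // v vd; exact: lt_le_trans lt_r (rle v vd).
Qed.

(** If no such [v] existed, [reg_sqn x + e] would belong to [reg_sqn_lower x], with [d = e]. *)
Lemma reg_sqn_gt x e : 0 < e ->
  exists2 v, sqn w v < e & sqn s (x - v) < reg_sqn x + e.
Proof.
move=> e0; apply/not_exists2P => H.
have : reg_sqn x + e <= reg_sqn x.
  apply: sup_upper_bound; first exact: has_sup_reg_sqn_lower.
  exists e => // v ve; rewrite leNgt; apply/negP => lt_v.
  by have [] := H v.
by rewrite gerDl leNgt e0.
Qed.

(** If [v'] is nearly optimal for [x - v], then [v + v'] is still [w]-small and competes in the
    infimum for [x]. *)
Lemma reg_sqn_lsc x e : 0 < e ->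
  exists2 d, 0 < d & forall v, sqn w v < d -> reg_sqn x - e < reg_sqn (x - v).
Proof.
move=> e0; have e20 : 0 < e / 2 by rewrite divr_gt0.
have [d d0 dP] := reg_sqn_lt x (e / 2) e20.
have d40 : 0 < d / 4 by rewrite divr_gt0.
exists (d / 4) => // v vd.
(* The minimum controls both the loss in [s] and the size in [w]; [d / 4] is used since [w[v + v']
   <= 2 * (w[v] + w[v'])]. *)
have [v' v'd v's] := reg_sqn_gt (x - v) (Num.min (e / 2) (d / 4))
  (ltac:(by rewrite lt_min e20 d40)).
have v'd4 : sqn w v' < d / 4 by rewrite (lt_le_trans v'd) // ge_min lexx orbT.
have v'e : sqn s (x - v - v') < reg_sqn (x - v) + e / 2.
  by rewrite (lt_le_trans v's) // lerD2l ge_min lexx.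
have := dP (v + v'); rewrite opprD addrA.
have := sqnD_le w v v' w0; lra.
Qed.

(** The filter is arbitrary so that pairs of indices are covered too, which later yields the Cauchy
    property. *)
Definition minimizing {T : Type} (F : set_system T) x (v : T -> D) :=
  sqn w (v i) @[i --> F] --> (0 : R) /\
  sqn s (x - v i) @[i --> F] --> reg_sqn x.

Lemma exists_minimizing :
  exists p : D -> nat -> D, forall x, minimizing \oo x (p x).
Proof.
have ex (xn : D * nat) : exists v, sqn w v < xn.2.+1%:R^-1 /\
    sqn s (xn.1 - v) < reg_sqn xn.1 + xn.2.+1%:R^-1.
  have [|v ? ?] := reg_sqn_gt xn.1 (xn.2.+1%:R^-1); first by rewrite invr_gt0.
  by exists v.
have [p pP] := choice ex.
exists (fun x n => p (x, n)) => x.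
have inv0 : n.+1%:R^-1 @[n --> \oo] --> (0 : R) by exact: cvg_harmonic.
have w_null : sqn w (p (x, n)) @[n --> \oo] --> (0 : R).
  by apply: cvg_null_le inv0 => n; rewrite sqn_ge0 //= ltW // (pP (x, n)).1.
split=> //; apply/cvgrPdist_lt => e e0.
(* The lower bound holds once [p (x, n)] is [w]-small; the upper bound is built into the choice of
   [p]. *)
have [d d0 dP] := reg_sqn_lt x e e0.
near=> n; rewrite distrC ltr_norml; apply/andP; split.
  rewrite ltrBrDl; apply: dP; rewrite (le_lt_trans (ler_norm _)) //.
  by near: n; move/cvgr0Pnorm_lt: w_null; apply.
rewrite ltrBlDl (lt_trans (pP (x, n)).2) //= ltrD2l (le_lt_trans (ler_norm _)) //.
by near: n; move/cvgr0Pnorm_lt: inv0; apply.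
Unshelve. all: by end_near.
Qed.

Section Orthogonality.
Context {T : Type} {F : set_system T} {FF : Filter F}.

(* Subtracting [(1/B) s(x - v, u) u] from [x - v] lowers [s] by at least
   [|s(x - v, u)|^2 / B], while [v] was already asymptotically optimal. *)
Lemma minimizing_orthogonal x (v u : T -> D) (B : R) :
  minimizing F x v -> sqn w (u i) @[i --> F] --> (0 : R) ->
  (\forall i \near F, sqn s (u i) <= B) ->
  Cabs (s (x - v i) (u i)) @[i --> F] --> (0 : R).
Proof.
move=> [wv sv] wu uB'; wlog B0 : B uB' / 0 < B.
  move=> /(_ (`|B| + 1)); apply; last by rewrite ltr_wpDl.
  apply: filterS uB' => i /le_trans; apply.
  by rewrite (le_trans (ler_norm _)) // lerDl.
apply/cvgr0Pnorm_lt => e e0.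
(* Chosen so that the final estimate [c2 / B < 2 * e'] reads [c2 < e ^+ 2]. *)
pose e' := e ^+ 2 / (2 * B).
have e'0 : 0 < e' by rewrite divr_gt0 ?exprn_gt0 // mulr_gt0.
have [d d0 dP] := reg_sqn_lt x e' e'0.
(* By Cauchy-Schwarz, [K] will bound the squared modulus of the coefficient of [u i], which keeps
   the modified competitor [w]-small; [K + 1] avoids division by zero. *)
pose K := B^-1 * (reg_sqn x + e').
have K0 : 0 <= K by rewrite mulr_ge0 ?invr_ge0 ?addr_ge0 ?reg_sqn_ge0 // ltW.
have d40 : 0 < d / 4 by rewrite divr_gt0.
have dK0 : 0 < d / 4 / (K + 1) by rewrite divr_gt0 // ltr_wpDl.
near=> i.
have vd : sqn w (v i) < d / 4.
  by rewrite (le_lt_trans (ler_norm _)) //; near: i; move/cvgr0Pnorm_lt: wv; apply.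
have ud : sqn w (u i) < d / 4 / (K + 1).
  by rewrite (le_lt_trans (ler_norm _)) //; near: i; move/cvgr0Pnorm_lt: wu; apply.
have uB : sqn s (u i) <= B by near: i.
have sd : sqn s (x - v i) < reg_sqn x + e'.
  rewrite -ltrBlDl (le_lt_trans (ler_norm _)) // distrC.
  by near: i; move/cvgrPdist_lt: sv; apply.
rewrite ger0_norm ?Cabs_ge0 // -(@ltr_pXn2r _ 2) ?nnegrE ?Cabs_ge0 ?(ltW e0) //.
set c := s (x - v i) (u i); set c2 := Cabs c ^+ 2.
have c20 : 0 <= c2 by rewrite sqr_ge0.
have c2B : c2 <= (reg_sqn x + e') * B.
  apply: (le_trans (Cauchy_Schwarz _ _ _ s0)).
  by apply: ler_pM; rewrite ?sqn_ge0 // ltW.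
have := dP (v i + (B^-1%:C * c) *: u i).
rewrite opprD addrA sqnB_projection // -/c -/c2.
have wd : sqn w (v i + (B^-1%:C * c) *: u i) < d.
  apply: (le_lt_trans (sqnD_le _ _ _ w0)).
  suff : sqn w ((B^-1%:C * c) *: u i) < d / 4 by lra.
  rewrite sqnZ ComplexField.Normc.normcM exprMn Cabs_real ?invr_ge0 ?ltW // -/c2.
  have cK : B^-1 ^+ 2 * c2 <= K.
    rewrite expr2 -mulrA ler_pM2l ?invr_gt0 // mulrC ler_pdivrMr //.
  apply: (@le_lt_trans _ _ (K * sqn w (u i))).
    by rewrite ler_wpM2r // sqn_ge0.
  apply: (@le_lt_trans _ _ ((K + 1) * sqn w (u i))).
    by rewrite ler_wpM2r ?sqn_ge0 // lerDl.
  by rewrite -ltr_pdivlMl ?ltr_wpDl // mulrC.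
move=> /(_ wd).
have : B^-1 ^+ 2 * c2 * sqn s (u i) <= B^-1 * c2.
  have -> : B^-1 * c2 = B^-1 ^+ 2 * c2 * B by field; rewrite gt_eqF.
  by rewrite ler_wpM2l // mulr_ge0 // exprn_ge0 // invr_ge0 ltW.
move=> h1 h2.
have : B^-1 * c2 < 2 * e' by lra.
rewrite ltr_pdivrMl //; have -> // : B * (2 * e') = e ^+ 2.
by rewrite /e'; field; rewrite gt_eqF.
Unshelve. all: by end_near.
Qed.

Lemma minimizing_near_bounded x (v : T -> D) : minimizing F x v ->
  \forall i \near F, sqn s (v i) <= 2 * (sqn s x + (reg_sqn x + 1)).
Proof.
move=> [_ /cvgrPdist_lt/(_ 1 ltr01)]; apply: filterS => i xv.
rewrite -[v i](subKr x) (le_trans (sqnB_le _ _ _ s0)) // ler_pM2l // lerD2l.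
by rewrite -lerBlDl ltW // (le_lt_trans (ler_norm _)) // distrC.
Qed.

(** The defect [u] is [w]-null and [s]-bounded, and it equals [a *: (x - vx) + (y - vy) - (a *: x +
    y - vz)]. Expanding [s[u]] in the first variable leaves three terms that vanish by
    orthogonality. *)
Lemma minimizing_linear a x y (vx vy vz : T -> D) :
  minimizing F x vx -> minimizing F y vy -> minimizing F (a *: x + y) vz ->
  sqn s (vz i - (a *: vx i + vy i)) @[i --> F] --> (0 : R).
Proof.
move=> mx my mz; set u := fun i => vz i - (a *: vx i + vy i).
have [B uB] : exists B, \forall i \near F, sqn s (u i) <= B.
  set Bx := 2 * (sqn s x + (reg_sqn x + 1)).
  set By := 2 * (sqn s y + (reg_sqn y + 1)).
  set Bz := 2 * (sqn s (a *: x + y) + (reg_sqn (a *: x + y) + 1)).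
  exists (2 * (Bz + 2 * (Cabs a ^+ 2 * Bx + By))).
  have := minimizing_near_bounded x vx mx.
  have := minimizing_near_bounded y vy my.
  have := minimizing_near_bounded (a *: x + y) vz mz.
  apply: filterS3 => i zi yi xi; rewrite (le_trans (sqnB_le _ _ _ s0)) //.
  rewrite ler_pM2l // lerD // (le_trans (sqnD_le _ _ _ s0)) // ler_pM2l //.
  by rewrite lerD // sqnZ ler_wpM2l // sqr_ge0.
have wu : sqn w (u i) @[i --> F] --> (0 : R).
  apply: (@cvg_null_le _ _ _ _ (fun i => 2 * (sqn w (vz i) +
      2 * (Cabs a ^+ 2 * sqn w (vx i) + sqn w (vy i))))) => [i|].
    rewrite sqn_ge0 //= (le_trans (sqnB_le _ _ _ w0)) //.
    by rewrite ler_pM2l // lerD2l (le_trans (sqnD_le _ _ _ w0)) // sqnZ.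
  rewrite -[X in _ --> X](_ : 2 * (0 + 2 * (Cabs a ^+ 2 * 0 + 0)) = 0); last ring.
  apply: cvgMl_tmp; apply: cvgD; first exact: mz.1.
  apply: cvgMl_tmp; apply: cvgD; last exact: my.1.
  by apply: cvgMl_tmp; exact: mx.1.
have ox := minimizing_orthogonal _ _ _ _ mx wu uB.
have oy := minimizing_orthogonal _ _ _ _ my wu uB.
have oz := minimizing_orthogonal _ _ _ _ mz wu uB.
apply: (@cvg_null_le _ _ _ _ (fun i => Cabs a * Cabs (s (x - vx i) (u i)) +
    Cabs (s (y - vy i) (u i)) + Cabs (s (a *: x + y - vz i) (u i)))) => [i|].
  rewrite sqn_ge0 //=; have /(le_trans (ler_norm _))/le_trans := abs_Re_le_Cabs (qform s (u i)).
  apply; have -> : qform s (u i) = a * s (x - vx i) (u i) + s (y - vy i) (u i)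
     - s (a *: x + y - vz i) (u i).
    rewrite -linearZl_LR -linearDl -linearBl /qform; congr (s _ _).
    by rewrite scalerBr addrACA -opprD subrBBr.
  rewrite (le_trans (Cabs_triangle _ _)) // CabsN lerD2r.
  by rewrite (le_trans (Cabs_triangle _ _)) // ComplexField.Normc.normcM.
rewrite -[X in _ --> X](_ : Cabs a * 0 + 0 + 0 = 0); last ring.
by apply: cvgD => //; apply: cvgD => //; exact: cvgMl_tmp.
Qed.

End Orthogonality.

End RegularPart.

(** * Absolute continuity and singularity of the two parts of [s] *)

Section Decomposition.
Local Open Scope complex_scope.
Context {R : realType} {D : lmodType R[i]}.
Variables (s w : {sesquiform D}).
Hypotheses (s0 : nonneg_form s) (w0 : nonneg_form w).
Local Notation reg := (reg_sqn s w).

(** Lower semicontinuity at the fixed point [u n]: for [m] large, [u m] is [w]-small, so [reg (u n)]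
    exceeds [reg (u n - u m)] by less than [e / 2], and the latter is small by hypothesis. *)
Lemma reg_sqn_closable (u : nat -> D) :
  sqn w (u n) @[n --> \oo] --> (0 : R) ->
  reg (u nm.1 - u nm.2) @[nm --> (\oo, \oo)] --> (0 : R) ->
  reg (u n) @[n --> \oo] --> (0 : R).
Proof.
move=> wu ru; apply/cvgr0Pnorm_lt => e e0.
have e20 : 0 < e / 2 by rewrite divr_gt0.
have /cvgr0Pnorm_lt/(_ _ e20) := ru.
case=> -[A B] /= [] /= [N _ NA] [M _ MB] AB.
near=> n; rewrite ger0_norm ?reg_sqn_ge0 //.
have [d d0 dP] := reg_sqn_lsc s w s0 w0 (u n) (e / 2) e20.
have [m [md mM]] : exists m, sqn w (u m) < d /\ (M <= m)%N.
  apply: (@filter_ex _ \oo); near=> m; split; last by near: m; exact: nbhs_infty_ge.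
  by rewrite (le_lt_trans (ler_norm _)) //; near: m; move/cvgr0Pnorm_lt: wu; apply.
have := dP (u m) md.
have /(le_lt_trans (ler_norm _)) : `|reg (u n - u m)| < e / 2.
  apply: (AB (n, m)); split; last exact: MB.
  by apply: NA; rewrite /=; near: n; exact: nbhs_infty_ge.
lra.
Unshelve. all: by end_near.
Qed.

Lemma minimizing_comp {T U : Type} (F : set_system T) (G : set_system U)
    (f : U -> T) x (v : T -> D) :
  f @ G --> F -> minimizing s w F x v -> minimizing s w G x (v \o f).
Proof. by move=> fG [wv sv]; split; [exact: cvg_comp fG wv|exact: cvg_comp fG sv]. Qed.

(** The factor [k] lets one proof serve both the regular part and its multiple in the mixed
    bound. *)
Lemma abs_continuous_reg (a : {sesquiform D}) (k : R) : 0 < k ->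
  (forall x, qform a x = (k * reg x)%:C) -> abs_continuous a w.
Proof.
move=> k0 aE u.
have reg0 x : 0 <= k * reg x by rewrite mulr_ge0 ?reg_sqn_ge0 // ltW.
move=> /(cvg0_qform w (sqn w)) wu /(cvg0_qform a _ (fun nm => u nm.1 - u nm.2) reg0 aE) ru.
apply/(cvg0_qform a _ u reg0 aE).
rewrite -[X in _ --> X](mulr0 k); apply: cvgMl_tmp; apply: reg_sqn_closable.
  by apply: wu => x; [exact: sqn_ge0|exact: nonneg_qformE].
have -> : (fun nm : nat * nat => reg (u nm.1 - u nm.2)) =
    (fun nm => k^-1 * (k * reg (u nm.1 - u nm.2))).
  by apply/funext => nm; rewrite mulKf // gt_eqF.
by rewrite -[X in _ --> X](mulr0 k^-1); apply: cvgMl_tmp.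
Qed.

Lemma form_lim_qform (T : {sesquiform D}) x (u : nat -> D) (r : R) :
  s (u n) (u n) @[n --> \oo] --> (T x x : R[i]^o) ->
  sqn s (u n) @[n --> \oo] --> r -> qform T x = r%:C.
Proof.
move=> sT sr; apply: (cvgC_unique _ _ _ sT); apply/cvgC_Cabs.
have sr0 : `|sqn s (u n) - r| @[n --> \oo] --> (0 : R).
  exact/norm_cvg0P/subr_cvg0.
apply: cvg_null_le sr0 => n.
rewrite Cabs_ge0 -[s _ _]/(qform s (u n)) nonneg_qformE // -rmorphB /=.
by rewrite expr0n addr0 sqrtr_sqr.
Qed.

Variable p : D -> nat -> D.
Hypothesis p_min : forall x, minimizing s w \oo x (p x).

Lemma minimizing_asymptotically_linear : asymptotically_linear s p.
Proof.
split=> [x|a x y]; last first.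
  exact: (minimizing_linear s w s0 w0 a x y _ _ _ (p_min x) (p_min y) (p_min _)).
(* The Cauchy property is uniqueness of minimizers along the product filter: both coordinates give
   minimizing families for [x], compared by [minimizing_linear] with scalar [0]. *)
have m1 : minimizing s w (filter_prod \oo \oo) x (fun nm => p x nm.1).
  exact: (minimizing_comp _ _ fst _ _ cvg_fst (p_min x)).
have m2 : minimizing s w (filter_prod \oo \oo) x (fun nm => p x nm.2).
  exact: (minimizing_comp _ _ snd _ _ cvg_snd (p_min x)).
have m3 : minimizing s w (filter_prod \oo \oo) (0 *: x + x) (fun nm => p x nm.1).
  by rewrite scale0r add0r.
under eq_fun => nm do rewrite -[p x nm.2]add0r -(scale0r (p x nm.1)).
exact: (minimizing_linear s w s0 w0 0 x x _ _ _ m1 m2 m3).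
Qed.

(** Pythagoras in the limit: [p x] is itself [w]-null and [s]-bounded, so it is asymptotically
    orthogonal to [x - p x n]. *)
Lemma sing_sqn_minimizing x : sqn s (p x n) @[n --> \oo] --> sqn s x - reg x.
Proof.
have [wp qx] := p_min x.
have sp0 : Cabs (s (x - p x n) (p x n)) @[n --> \oo] --> (0 : R).
  apply: (minimizing_orthogonal s w s0 w0 _ _ _ _ (p_min x) wp).
  exact: (minimizing_near_bounded s w s0 x (p x) (p_min x)).
have Re0 : complex.Re (s (x - p x n) (p x n)) @[n --> \oo] --> (0 : R).
  by apply/norm_cvg0P; apply: cvg_null_le sp0 => n; rewrite normr_ge0 abs_Re_le_Cabs.
rewrite -[X in _ --> X](_ : sqn s x - reg x - 2 * 0 = _); last by rewrite mulr0 subr0.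
have -> : (fun n => sqn s (p x n)) = (fun n => sqn s x - sqn s (x - p x n) -
    2 * complex.Re (s (x - p x n) (p x n))).
  apply/funext => n; have := sqnD s (x - p x n) (p x n) s0.
  by rewrite subrK => ->; ring.
by apply: cvgB; [apply: cvgB; [exact: cvg_cst|exact: qx]|exact: cvgMl_tmp].
Qed.

(** Here [s[x - p x n]] tends to [reg x], while lower semicontinuity keeps [reg (x - p x n)] from
    dropping below [reg x] in the limit. *)
Lemma sing_sqn_residual x :
  sqn s (x - p x n) - reg (x - p x n) @[n --> \oo] --> (0 : R).
Proof.
have [wp sp] := p_min x.
apply/cvgr0Pnorm_lt => e e0; have e20 : 0 < e / 2 by rewrite divr_gt0.
have [d d0 dP] := reg_sqn_lsc s w s0 w0 x (e / 2) e20.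
near=> n; rewrite ger0_norm ?subr_ge0 ?reg_sqn_le //.
have : reg x - e / 2 < reg (x - p x n).
  apply: dP; rewrite (le_lt_trans (ler_norm _)) //.
  by near: n; move/cvgr0Pnorm_lt: wp; apply.
have : sqn s (x - p x n) - reg x < e / 2.
  rewrite (le_lt_trans (ler_norm _)) // distrC.
  by near: n; move/cvgrPdist_lt: sp; apply.
lra.
Unshelve. all: by end_near.
Qed.

(** Since [reg <= s], the [s]-Cauchy and [w]-null sequence [p x] falls under closability. *)
Lemma reg_sqn_minimizing x : reg (p x n) @[n --> \oo] --> (0 : R).
Proof.
apply: reg_sqn_closable; first exact: (p_min x).1.
apply: cvg_null_le (minimizing_asymptotically_linear.1 x) => nm.
by rewrite reg_sqn_ge0 // reg_sqn_le.
Qed.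

Lemma singular_sing (b : {sesquiform D}) :
  (forall x, qform b x = (sqn s x - reg x)%:C) -> singular b w.
Proof.
move=> bE x; exists (p x); split.
  apply/(cvg0_qform w (sqn w)) => [y|y|]; [exact: sqn_ge0|exact: nonneg_qformE|].
  exact: (p_min x).1.
apply/(cvg0_qform b _ (fun n => x - p x n) _ bE); last exact: sing_sqn_residual.
by move=> y; rewrite subr_ge0 reg_sqn_le.
Qed.

(** The complementary sequence [x - p x n] works: the singular part vanishes on it, and the regular
    part vanishes on its difference [p x n] from [x]. *)
Lemma singular_reg_sing (a b : {sesquiform D}) (k : R) : 0 <= k ->
  (forall x, qform a x = (k * reg x)%:C) ->
  (forall x, qform b x = (sqn s x - reg x)%:C) -> singular a b.
Proof.
move=> k0 aE bE x; exists (fun n => x - p x n); split.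
  apply/(cvg0_qform b _ (fun n => x - p x n) _ bE); last exact: sing_sqn_residual.
  by move=> y; rewrite subr_ge0 reg_sqn_le.
apply/(cvg0_qform a _ (fun n => x - (x - p x n)) _ aE) => [y|].
  by rewrite mulr_ge0 ?reg_sqn_ge0.
have -> : (fun n => k * reg (x - (x - p x n))) = (fun n => k * reg (p x n)).
  by apply/funext => n; rewrite subKr.
by rewrite -[X in _ --> X](mulr0 k); apply: cvgMl_tmp; exact: reg_sqn_minimizing.
Qed.

End Decomposition.

(** * Assembly of the three parts of [t] *)

Theorem theorem3p1 (R : realType) (D : lmodType R[i]) (t w : {sesquiform D})
    (w_ge0 : nonneg_form w) (Mt_neq0 : majorants t !=set0) :
  forall s : {sesquiform D}, majorants t s ->
  exists tr tm tss : {sesquiform D},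
    [/\ forall phi psi : D,
          t phi psi = tr phi psi + tm phi psi + tss phi psi,
        regular tr w, mixed tm w & strongly_singular tss w].
Proof.
move=> s /majorants_dominates[s0 st].
have ss : dominates s s by move=> x y; exact: Cauchy_Schwarz.
have [p p_min] := exists_minimizing s w s0 w_ge0.
have pA := minimizing_asymptotically_linear s w s0 w_ge0 p p_min.
have qA := asymptotically_linearB s p pA.
have p_lim x := sing_sqn_minimizing s w s0 w_ge0 p p_min x.
have q_lim x := (p_min x).2.
(* Extending [s] itself shows that the regular and singular quadratic parts come from sesquilinear
   forms, [<Q x, Q y>] and [<P x, P y>]. *)
have [sr sr_lim] := extension_form s s s0 ss _ _ qA qA.
have [sg sg_lim] := extension_form s s s0 ss _ _ pA pA.
have srE x := form_lim_qform s s0 sr x _ _ (sr_lim x x) (q_lim x).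
have sgE x := form_lim_qform s s0 sg x _ _ (sg_lim x x) (p_lim x).
have sr_sqn x : sqn sr x = reg_sqn s w x by rewrite /sqn srE.
have sg_sqn x : sqn sg x = sqn s x - reg_sqn s w x by rewrite /sqn sgE.
have sr0 : nonneg_form sr by move=> x; rewrite srE ler0c reg_sqn_ge0.
have sg0 : nonneg_form sg by move=> x; rewrite sgE ler0c subr_ge0 reg_sqn_le.
(* The factor 4 absorbs the two cross terms of the mixed part. *)
have [a aE] : exists a : {sesquiform D}, forall x y, a x y = 4 * sr x y.
  apply: bilinear_sesquiform => [c x x' y|c x y y'].
    by rewrite (linearDl sr) (linearZl_LR sr); ring.
  by rewrite (linearDr sr) (linearZr_LR sr) /=; ring.
have aqE x : qform a x = ((4 * reg_sqn s w x)%:C)%C.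
  by rewrite /qform aE -[sr x x]/(qform sr x) srE rmorphM /= rmorph_nat.
have a0 : nonneg_form a by move=> x; rewrite aqE ler0c mulr_ge0 ?reg_sqn_ge0.
have a_sqn x : sqn a x = 4 * reg_sqn s w x by rewrite /sqn aqE.
have [tr tr_lim] := extension_form s t s0 st _ _ qA qA.
have [tss tss_lim] := extension_form s t s0 st _ _ pA pA.
have [tqp tqp_lim] := extension_form s t s0 st _ _ qA pA.
have [tpq tpq_lim] := extension_form s t s0 st _ _ pA qA.
have [tm tmE] : exists tm : {sesquiform D},
    forall x y, tm x y = tqp x y + tpq x y.
  apply: bilinear_sesquiform => [c x x' y|c x y y'].
    by rewrite !(linearDl tqp, linearDl tpq, linearZl_LR tqp, linearZl_LR tpq); ring.
  by rewrite !(linearDr tqp, linearDr tpq, linearZr_LR tqp, linearZr_LR tpq) /=; ring.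
have tqp_le x : Cabs (tqp x x) ^+ 2 <= reg_sqn s w x * sqn sg x.
  by rewrite sg_sqn; exact: Cabs_lim_le st _ _ _ _ _ (tqp_lim x x) (q_lim x) (p_lim x).
have tpq_le x : Cabs (tpq x x) ^+ 2 <= reg_sqn s w x * sqn sg x.
  rewrite sg_sqn mulrC.
  exact: Cabs_lim_le st _ _ _ _ _ (tpq_lim x x) (p_lim x) (q_lim x).
exists tr, tm, tss; split.
- move=> x y; rewrite tmE.
  (* Expanding both arguments by [1 = P + Q] makes [f] constantly [t x y], while its four terms
     converge to the forms just built. *)
  pose f n := t (x - p x n) (y - p y n) +
    (t (x - p x n) (p y n) + t (p x n) (y - p y n)) + t (p x n) (p y n).
  have fE n : f n = t x y.
    rewrite /f addrA -linearDr subrK -addrA -linearDr subrK.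
    by rewrite -linearDl subrK.
  apply: (cvgC_unique (F := \oo) f).
    apply/cvgC_Cabs; apply: cvg_near_cst; apply: nearW => n.
    by rewrite fE subrr ComplexField.Normc.normc0.
  apply: (@cvgD R[i] R[i]^o); last exact: tss_lim.
  apply: (@cvgD R[i] R[i]^o); first exact: tr_lim.
  by apply: (@cvgD R[i] R[i]^o).
- exists sr; split; last first.
    by apply: (abs_continuous_reg s w s0 w_ge0 sr 1) => // x; rewrite mul1r.
  apply/majorants_dominates; split=> // x y; rewrite !sr_sqn.
  exact: Cabs_lim_le st _ _ _ _ _ (tr_lim x y) (q_lim x) (q_lim y).
- exists a, sg; split=> //.
  + by apply: (abs_continuous_reg s w s0 w_ge0 a 4).
  + exact: (singular_sing s w s0 w_ge0 p p_min).
  + by apply: (singular_reg_sing s w s0 w_ge0 p p_min a sg 4).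
  + move=> x; apply/le_sqrtC_qform => //; rewrite a_sqn /qform tmE.
    have := tqp_le x; have := tpq_le x.
    set A := Cabs (tqp x x); set B := Cabs (tpq x x).
    have A0 : 0 <= A by exact: Cabs_ge0.
    have B0 : 0 <= B by exact: Cabs_ge0.
    have : Cabs (tqp x x + tpq x x) ^+ 2 <= (A + B) ^+ 2.
      by rewrite ler_pXn2r ?nnegrE ?Cabs_ge0 ?addr_ge0 // Cabs_triangle.
    (* [(A + B)^2 <= 2 * (A^2 + B^2)], and each square is at most [reg_sqn s w x * sqn sg x]. *)
    have := sqr_ge0 (A - B); rewrite -mulrA; nra.
- exists sg; split; last exact: (singular_sing s w s0 w_ge0 p p_min).
  apply/majorants_dominates; split=> // x y; rewrite !sg_sqn.
  exact: Cabs_lim_le st _ _ _ _ _ (tss_lim x y) (p_lim x) (p_lim y).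
Qed.
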